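(* Let $c_+,c_->0$, let $B=\{B(t),t\ge0\}$ be a càdlàg stochastic process, and let $\widetilde X(t)$, $t\ge0$, be a solution to the SDE $$\widetilde X(t)=\int_0^t \bigl(c_+\mathbf 1_{\widetilde X(s)\geq 0} -c_-\mathbf 1_{\widetilde X(s)< 0}\bigr)|\widetilde X(s)|^\alpha ds + B(t),\quad t\geq 0.$$ Suppose that either 1) $\alpha\in(0,1)$ and there exist a function $h$ with $h(t)=o(t^{\frac1{1-\alpha}})$, $t\to\infty$, and a (random) sequence $\{t_n\}$ with $\lim_{n\to\infty}t_n=\infty$ such that $$|B(t)-B(t_n)|\le h(t-t_n),\quad t\ge t_n,\ \text{for all } n,\ \text{a.s.};$$ or 2) $\alpha\in(-1,0]$ and $B(t)=o(t^{\frac1{1-\alpha}})$, $t\to\infty$, a.s. Then, as $t\to\infty$, $$\widetilde X(t)\sim (c_+(1-\alpha)t)^{\frac1{1-\alpha}}\quad\text{for a.a. } \omega\in\{\lim_{t\to\infty}\widetilde X(t)=+\infty\},$$ $$\widetilde X(t)\sim -(c_-(1-\alpha)t)^{\frac1{1-\alpha}}\quad\text{for a.a. } \omega\in\{\lim_{t\to\infty}\widetilde X(t)=-\infty\}.$$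
   Context: All processes have càdlàg trajectories. The notation $u(t)\sim v(t)$, $t\to\infty$, means $\lim_{t\to\infty}u(t)/v(t)=1$. ''For a.a. $\omega\in A$'' means for all $\omega\in A$ outside a set of probability zero. *)

(* Defs.v *)
From HB Require Import structures.
From mathcomp Require Import all_boot all_order all_algebra.
From mathcomp Require Import all_classical all_reals all_analysis.

Set Implicit Arguments.
Unset Strict Implicit.
Unset Printing Implicit Defensive.

Import Order.TTheory GRing.Theory Num.Theory.
Import numFieldNormedType.Exports.

Local Open Scope classical_set_scope.
Local Open Scope ring_scope.

(* Lets the Landau notation =o_+oo be used for functions of a real variable. *)
Canonical pinfty_filter_on (R : numFieldType) : filter_on R :=
  FilterType (pinfty_nbhs R) _.

(* A path is a function R -> R of which only the values at times t >= 0 are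
   meaningful; no definition below depends on its values at negative times. *)
Definition cadlag (R : realType) (f : R -> R) : Prop :=
  (forall t, 0 <= t -> f s @[s --> t^'+] --> f t) /\
  (forall t, 0 < t -> cvg (f s @[s --> t^'-])).

(* |x|^alpha, equal to +oo when x = 0 and alpha < 0 (whereas powR and poweR
   give 0 there). When alpha = 0 its value is 1 everywhere, including x = 0. *)
Definition abs_pow (R : realType) (alpha x : R) : \bar R :=
  if (x == 0) && (alpha < 0) then +oo%E else (`|x| `^ alpha)%:E.

Definition drift (R : realType) (cp cm alpha x : R) : \bar R :=
  ((cp * \1_[set y | 0 <= y] x - cm * \1_[set y | y < 0] x)%:E
   * abs_pow alpha x)%E.

Definition solves_SDE (d : measure_display) (T : measurableType d)
    (R : realType) (P : probability T R) (cp cm alpha : R)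
    (B X : R -> {RV P >-> R}) : Prop :=
  {ae P, forall w, forall t, 0 <= t ->
    (@lebesgue_measure R).-integrable `[0, t]
      (fun s => drift cp cm alpha (X s w)) /\
    (X t w)%:E = (\int[@lebesgue_measure R]_(s in `[0%R, t])
                    drift cp cm alpha (X s w) + (B t w)%:E)%E}.

(* Stated as a limit of the quotient rather than with the Landau relation
   u = v +o v, which is a different (though related) definition. *)
Definition equiv_pinfty (R : realType) (u v : R -> R) : Prop :=
  u t / v t @[t --> +oo] --> (1 : R).

(* Main.v *)
Require Import Defs.
From HB Require Import structures.
From mathcomp Require Import all_boot all_order all_algebra.
From mathcomp Require Import all_classical all_reals all_analysis.
From mathcomp Require Import ring lra.

Import Order.TTheory GRing.Theory Num.Theory.
Import numFieldNormedType.Exports.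

Local Open Scope classical_set_scope.
Local Open Scope ring_scope.

(** The statement is pathwise: almost surely the trajectories [x = X w] and
    [b = B w] satisfy a deterministic integral equation, and everything below is
    about one such pair.  Suppose that [x] tends to [+oo]; the other case follows
    by changing the signs of [x] and [b] ([solution_equiv_ninfty]).  From some
    time on [x] is positive and [x - b] is an indefinite integral of
    [c x^alpha], to be compared with the solution [v] of [v' = c v^alpha] issued
    from [0], which is the announced equivalent ([profile]).  The hypotheses imply
    that the noise [b] is negligible with respect to [v].

    If [0 < alpha], the drift is increasing: a path ahead of a barrier moves
    faster than it and stays ahead.  The curves [psi r = v (m * (r + L))] satisfy
    [psi' = m c psi^alpha].  For [1 < m], a path below [psi] up to the noise
    moves more slowly than [psi], and a large shift [L] makes [psi] start above
    the path ([path_upper_pos]).  For [m < 1], a path above [psi] up to the noise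
    moves faster than [psi] ([path_lower_pos]); here the noise could keep a path
    close to the unstable point [0], and one has to restart the comparison at a
    time [tau n] when [x] is already large while the later increments of the
    noise obey a bound that does not depend on [n].  Both barriers are
    eventually comparable to [k * v t] with [k] as close to [1] as wanted.

    If [alpha <= 0], the drift is nonincreasing, hence stabilizing: while [x] is
    above [v], [x - b] moves more slowly than [v]; while [x] is below [v], it
    moves faster.  Smallness of [b] at infinity is then enough, and the comparison
    starts from the last time at which the path was on the right side of a
    barrier close to [v] ([path_upper_neg], [path_lower_neg]). *)

(** * Barriers for continuous functions *)

(** Compactness of [{r in [a, b] | g r <= 0}] provides its least element, and
    the intermediate value theorem forces [g] to vanish there. *)
Lemma first_zero {R : realType} (g : R -> R) (a b : R) :
  a <= b -> {within `[a, b], continuous g} -> 0 < g a -> g b <= 0 ->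
  exists2 u, a <= u <= b & g u = 0 /\ (forall r, a <= r < u -> 0 < g r).
Proof.
move=> ab cg ga gb.
pose A := `[a, b]%classic `&` g @^-1` [set y | y <= 0].
have cA : compact A.
  apply: (@subclosed_compact R A `[a, b]%classic);
    [|exact: segment_compact|by move=> ? []].
  rewrite /A (@closed_setSI R _ (g @^-1` [set y | y <= 0])); last first.
    exact: itv_closed.
  by apply: closed_comp => //; exact: closed_le.
have A0 : A !=set0 by exists b; split => //=; rewrite in_itv/= ab lexx.
have [u uA umin] :=
  @compact_EVT_min _ _ id _ A0 cA (continuous_subspaceT (fun x => cvg_id)).
move: uA; rewrite inE => -[/=]; rewrite in_itv/= => /andP[au ub] gu.
have pos r : a <= r < u -> 0 < g r.
  move=> /andP[ar ru]; rewrite ltNge; apply/negP => gr.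
  have : u <= r.
    apply: umin; rewrite inE; split => //=.
    by rewrite in_itv/= ar (le_trans (ltW ru) ub).
  by rewrite leNgt ru.
exists u; first by rewrite au.
split => //.
have cgu : {within `[a, u], continuous g}.
  apply: continuous_subspaceW cg => x /=.
  by rewrite !in_itv/= => /andP[-> /le_trans]; exact.
have [|z] := @IVT _ g a u 0 au cgu.
  by rewrite ge_min gu orbT le_max (ltW ga).
rewrite in_itv/= => /andP[az zu] gz.
have [zu'|] := ltP z u; first by have := pos z; rewrite az zu' gz ltxx => /(_ isT).
by move=> uz; rewrite -gz; congr g; apply/le_anti; rewrite uz zu.
Qed.

(** At the first zero [u] of [g] the hypothesis on [g] applies to the whole of
    [[a, u]] and gives [0 < g a <= g u = 0].  This form serves increasing drifts
    ([0 < alpha]): as long as the path is on the good side of the barrier, its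
    increments are on the good side too. *)
Lemma barrier_first {R : realType} (g : R -> R) (a b : R) :
  a <= b -> {within `[a, b], continuous g} -> 0 < g a ->
  (forall u, a <= u <= b ->
     (forall r, a <= r <= u -> 0 <= g r) -> g a <= g u) ->
  0 < g b.
Proof.
move=> ab cg ga H; rewrite ltNge; apply/negP => gb.
have [u aub [gu pos]] := first_zero g a b ab cg ga gb.
have : g a <= g u.
  apply: H => // r /andP[ar]; rewrite le_eqVlt => /predU1P[->|ru].
    by rewrite gu.
  by apply/ltW/pos; rewrite ar.
by rewrite gu leNgt ga.
Qed.

(** At the last zero [u] of [g] before [b] the hypothesis on [g] applies to
    [[u, b]] and gives [0 = g u <= g b].  This form serves nonincreasing drifts
    ([alpha <= 0]): it is on the bad side of the barrier that the increments of
    the path push it back. *)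
Lemma barrier_last {R : realType} (g : R -> R) (a b : R) :
  a <= b -> {within `[a, b], continuous g} -> 0 <= g a ->
  (forall u, a <= u <= b ->
     (forall r, u <= r <= b -> g r <= 0) -> g u <= g b) ->
  0 <= g b.
Proof.
move=> ab cg ga H; rewrite leNgt; apply/negP => gb.
(* The last zero of g is the first one of its rotation about the origin. *)
have cG : {within `[- b, - a], continuous (fun r => - g (- r))}.
  have /= := @within_continuous_compN _ _ _ g (- b) (- a).
  rewrite !opprK => /(_ cg) cgN.
  move=> r; apply: cvgN; exact: cgN.
have [|||u /andP[bu ua] [gu pos]] := first_zero _ _ _ _ cG.
- by rewrite lerN2.
- by rewrite opprK oppr_gt0.
- by rewrite opprK oppr_le0.
have gu0 : g (- u) = 0 by apply/eqP; rewrite -oppr_eq0 gu.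
have : g (- u) <= g b.
  apply: H; first by rewrite lerNr ua lerNl bu.
  move=> r /andP[]; rewrite le_eqVlt => /predU1P[<-|ur rb]; first by rewrite gu0.
  rewrite -oppr_ge0 -(opprK r); apply/ltW/pos.
  by rewrite lerN2 rb ltrNl ur.
by rewrite gu0 leNgt gb.
Qed.

(** * Powers and the deterministic profile *)

Lemma continuous_powR {R : realType} (a x : R) :
  0 < x -> {for x, continuous (fun y => y `^ a)}.
Proof.
move=> x0; apply/differentiable_continuous/derivable1_diffP.
by have [] := is_derive1_powR a x0.
Qed.

Lemma Rintegral_is_derive {R : realType} (F f : R -> R) (a b : R) :
  a <= b -> (forall r, a <= r <= b -> is_derive r 1 F (f r)) ->
  {within `[a, b], continuous f} ->
  lebesgue_measure.-integrable `[a, b] (EFin \o f) /\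
  \int[lebesgue_measure]_(r in `[a, b]) f r = F b - F a.
Proof.
move=> ab dF cf; split.
  by apply: continuous_compact_integrable => //; exact: segment_compact.
have [ab'|] := ltP a b; last first.
  move=> ba; have -> : b = a by apply/le_anti; rewrite ab ba.
  by rewrite set_itv1 Rintegral_set1 subrr.
have cF r : a <= r <= b -> {for r, continuous F}.
  move=> arb; apply/differentiable_continuous/derivable1_diffP.
  by have [] := dF _ arb.
have dFo r : r \in `]a, b[ -> is_derive r 1 F (f r).
  by rewrite in_itv/= => /andP[/ltW ar /ltW rb]; apply: dF; rewrite ar.
rewrite /Rintegral (@continuous_FTC2 _ f F)//.
- split.
  + by move=> r /dFo[].
  + by apply: cvg_at_right_filter; apply: cF; rewrite lexx.
  + by apply: cvg_at_left_filter; apply: cF; rewrite lexx andbT.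
- by move=> r /dFo dFr; rewrite derive1E derive_val.
Qed.

(** The maximal solution of [v' = c v^alpha] started from [0]: the deterministic
    growth that the path is shown to follow. *)
Definition profile {R : realType} (c alpha t : R) : R :=
  (c * (1 - alpha) * t) `^ (1 - alpha)^-1.

Lemma profile_gt0 {R : realType} (c alpha t : R) :
  0 < c -> alpha < 1 -> 0 < t -> 0 < profile c alpha t.
Proof. by move=> c0 a1 t0; rewrite powR_gt0// !mulr_gt0// subr_gt0. Qed.

Lemma profile_le {R : realType} (c alpha s t : R) :
  0 < c -> alpha < 1 -> 0 <= s -> s <= t ->
  profile c alpha s <= profile c alpha t.
Proof.
move=> c0 a1 s0 st; have ca : 0 <= c * (1 - alpha).
  by rewrite ltW// mulr_gt0 ?subr_gt0.
apply: ge0_ler_powR; rewrite ?nnegrE ?invr_ge0 ?subr_ge0 ?(ltW a1)//.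
- by rewrite mulr_ge0.
- by rewrite mulr_ge0// (le_trans s0).
- by rewrite ler_wpM2l.
Qed.

Lemma profileM {R : realType} (c alpha m t : R) :
  0 < c -> alpha < 1 -> 0 <= m -> 0 <= t ->
  profile c alpha (m * t) = m `^ (1 - alpha)^-1 * profile c alpha t.
Proof.
move=> c0 a1 m0 t0; rewrite /profile -powRM//; first by congr (_ `^ _); ring.
by rewrite mulr_ge0// ltW// mulr_gt0 ?subr_gt0.
Qed.

Lemma profile_pinfty {R : realType} (c alpha : R) : 0 < c -> alpha < 1 ->
  profile c alpha t @[t --> +oo] --> +oo.
Proof.
move=> c0 a1; apply/cvgryPge => A.
have ca : 0 < c * (1 - alpha) by rewrite mulr_gt0 ?subr_gt0.
set B := (Num.max A 1) `^ (1 - alpha).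
near=> t.
have B0 : 0 <= B by exact: powR_ge0.
have Bt : B / (c * (1 - alpha)) <= t by near: t; exact: nbhs_pinfty_ge (num_real _).
have : profile c alpha (B / (c * (1 - alpha))) <= profile c alpha t.
  by apply: profile_le => //; rewrite divr_ge0// ltW.
apply: le_trans; rewrite /profile mulrC divfK ?gt_eqF//.
rewrite /B -powRrM divff ?subr_eq0 ?gt_eqF// powRr1; first by rewrite le_max lexx.
by rewrite le_max ler01 orbT.
Unshelve. all: by end_near. Qed.

(** The barriers are [psi r = profile (m * (r + L))]: they solve
    [psi' = m c psi^alpha], so that [m] speeds the drift up ([1 < m]) or slows
    it down ([m < 1]), leaving room for the noise, while the shift [L] adjusts the
    initial value. *)
Lemma is_derive_profile {R : realType} (c alpha m L r : R) :
  0 < c -> alpha < 1 -> 0 < m -> 0 < r + L ->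
  is_derive r 1 (fun r => profile c alpha (m * (r + L)))
    (m * (c * profile c alpha (m * (r + L)) `^ alpha)).
Proof.
move=> c0 a1 m0 rL.
set b := (1 - alpha)^-1; set k := c * (1 - alpha).
have k0 : 0 < k by rewrite mulr_gt0 ?subr_gt0.
have a0 : 1 - alpha != 0 by rewrite gt_eqF ?subr_gt0.
have z0 : 0 < k * (m * (r + L)) by rewrite mulr_gt0// mulr_gt0.
have dlin : is_derive r 1 (fun r => k * (m * (r + L))) (k * m).
  by apply: is_derive_eq; rewrite /GRing.scale/=; ring.
have dpow := is_derive1_powR b z0.
have dcomp := @is_derive1_comp R (fun y => y `^ b)
  (fun r => k * (m * (r + L))) r _ _ dpow dlin.
apply: (is_derive_eq dcomp).
rewrite /profile -/k -/b -powRrM.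
have -> : b * alpha = b - 1 by rewrite /b; field.
by rewrite /k /b; field.
Qed.

Lemma Rintegral_profile {R : realType} (c alpha m L a b : R) :
  0 < c -> alpha < 1 -> 0 < m -> 0 < a + L -> a <= b ->
  lebesgue_measure.-integrable `[a, b]
    (EFin \o (fun r => m * (c * profile c alpha (m * (r + L)) `^ alpha))) /\
  \int[lebesgue_measure]_(r in `[a, b])
    (m * (c * profile c alpha (m * (r + L)) `^ alpha)) =
  profile c alpha (m * (b + L)) - profile c alpha (m * (a + L)).
Proof.
move=> c0 a1 m0 aL ab.
apply: (@Rintegral_is_derive R (fun r => profile c alpha (m * (r + L)))) => //.
  move=> r /andP[ar _]; apply: is_derive_profile => //.
  by rewrite (lt_le_trans aL)// lerD2r.
apply/subspace_continuousP => r /=; rewrite in_itv/= => /andP[ar _].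
have rL : 0 < r + L by rewrite (lt_le_trans aL)// lerD2r.
apply: cvg_within_filter; apply: cvgM; first exact: cvg_cst.
apply: cvgM; first exact: cvg_cst.
apply: (@continuous_comp R R R (fun r => profile c alpha (m * (r + L)))
  (fun y => y `^ alpha)).
  apply/differentiable_continuous/derivable1_diffP.
  by have [] := is_derive_profile c alpha m L r c0 a1 m0 rL.
by apply: continuous_powR; rewrite profile_gt0// mulr_gt0.
Qed.

Lemma within_continuous_profile {R : realType} (c alpha m L a b : R) :
  0 < c -> alpha < 1 -> 0 < m -> 0 < a + L ->
  {within `[a, b], continuous (fun r => profile c alpha (m * (r + L)))}.
Proof.
move=> c0 a1 m0 aL; apply/subspace_continuousP => r /=.
rewrite in_itv/= => /andP[ar _].
have rL : 0 < r + L by rewrite (lt_le_trans aL)// lerD2r.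
apply: cvg_within_filter.
apply/differentiable_continuous/derivable1_diffP.
by have [] := is_derive_profile c alpha m L r c0 a1 m0 rL.
Qed.

(** * Comparison of increments *)

(** The equation of the path after a time [T0] from which it keeps its sign.
    Only increments are mentioned, so that the history before [T0], where the
    drift may be infinite, disappears. *)
Definition power_drift_from {R : realType} (c alpha : R) (x b : R -> R)
    (T0 : R) :=
  forall s t, T0 <= s -> s <= t ->
    (@lebesgue_measure R).-integrable `[s, t]
      (EFin \o (fun r => c * `|x r| `^ alpha)) /\
    (x t - b t) - (x s - b s) =
      \int[@lebesgue_measure R]_(r in `[s, t]) (c * `|x r| `^ alpha).

Section comparison.
Context {R : realType} {c alpha : R} {x b : R -> R} {T0 : R}.
Context (xeq : power_drift_from c alpha x b T0).
Context (c0 : 0 < c) (a1 : alpha < 1).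

(** Only the noise jumps: [x - b] is an indefinite integral. *)
Lemma within_continuous_path s t : T0 <= s -> s <= t ->
  {within `[s, t], continuous (fun r => x r - b r)}.
Proof.
move=> Ts st; have [intf _] := xeq s t Ts st.
have := parameterized_integral_continuous st intf.
move=> cI; have : {within `[s, t], continuous (fun r => x s - b s +
    parameterized_integral lebesgue_measure s r (fun r => c * `|x r| `^ alpha))}.
  by move=> r; apply: cvgD; [exact: cvg_cst|exact: cI].
apply: subspace_eq_continuous => r; rewrite inE/= in_itv/= => /andP[sr rt].
have [_] := xeq s r Ts sr.
  by rewrite /from_subspace /= /parameterized_integral => <-; ring.
Qed.

Lemma path_nondecreasing s t : T0 <= s -> s <= t -> x s - b s <= x t - b t.
Proof.
move=> Ts st; have [_ E] := xeq s t Ts st.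
rewrite -subr_ge0 E; apply: Rintegral_ge0 => r _.
by rewrite mulr_ge0 ?powR_ge0 ?ltW.
Qed.

Lemma path_increment_le m L s t :
  T0 <= s -> s <= t -> 0 < m -> 0 < s + L ->
  (forall r, s <= r <= t ->
    `|x r| `^ alpha <= m * profile c alpha (m * (r + L)) `^ alpha) ->
  (x t - b t) - (x s - b s) <=
    profile c alpha (m * (t + L)) - profile c alpha (m * (s + L)).
Proof.
move=> Ts st m0 sL H; have [ix ->] := xeq s t Ts st.
have [ip <-] := Rintegral_profile c alpha m L s t c0 a1 m0 sL st.
apply: le_Rintegral => // r /=; rewrite in_itv/= => rst.
by rewrite mulrCA ler_pM2l// H.
Qed.

Lemma path_increment_ge m L s t :
  T0 <= s -> s <= t -> 0 < m -> 0 < s + L ->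
  (forall r, s <= r <= t ->
    m * profile c alpha (m * (r + L)) `^ alpha <= `|x r| `^ alpha) ->
  profile c alpha (m * (t + L)) - profile c alpha (m * (s + L)) <=
    (x t - b t) - (x s - b s).
Proof.
move=> Ts st m0 sL H; have [ix ->] := xeq s t Ts st.
have [ip <-] := Rintegral_profile c alpha m L s t c0 a1 m0 sL st.
apply: le_Rintegral => // r /=; rewrite in_itv/= => rst.
by rewrite mulrCA ler_pM2l// H.
Qed.

End comparison.

(** * Smallness of the noise *)

Lemma ler_powR_neg {R : realType} (a u v : R) :
  a <= 0 -> 0 < u -> u <= v -> v `^ a <= u `^ a.
Proof.
move=> a0 u0 uv; have v0 := lt_le_trans u0 uv.
rewrite -[a]opprK (powRN v) (powRN u) lef_pV2 ?posrE ?powR_gt0//.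
by apply: ge0_ler_powR; rewrite ?nnegrE ?oppr_ge0 ?(ltW u0) ?(ltW v0).
Qed.

Lemma near_pinfty_ex {R : realType} (P : R -> Prop) (T0 : R) :
  (\forall t \near +oo, P t) ->
  exists2 M, T0 <= M /\ 0 < M & forall t, M <= t -> P t.
Proof.
move=> [M [_ MP]]; exists (Num.max T0 (Num.max (M + 1) 1)).
  by rewrite le_max lexx/= !lt_max ltr01 !orbT.
move=> t; rewrite !ge_max => /and3P[_ Mt _]; apply: MP.
by rewrite (lt_le_trans _ Mt)// ltrDl.
Qed.

Definition noise_small {R : realType} (c alpha : R) (b : R -> R) :=
  forall e, 0 < e -> \forall t \near +oo, `|b t| <= e * profile c alpha t.

(** The same smallness, restarted at arbitrarily late times [tau n] and uniform
    in [n]: the comparison can then start when the path is as high as wanted,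
    with the noise forgotten. *)
Definition noise_small_after {R : realType} (c alpha : R) (b : R -> R) :=
  exists (h : R -> R) (tau : nat -> R),
    [/\ forall e, 0 < e -> \forall u \near +oo, h u <= e * profile c alpha u,
        tau n @[n --> \oo] --> +oo &
        forall n t, tau n <= t -> `|b t - b (tau n)| <= h (t - tau n)].

(** A single restarting time is enough: [b (tau n)] is a constant, absorbed by
    the growth of the profile. *)
Lemma noise_small_after_small {R : realType} (c alpha : R) (b : R -> R) :
  0 < c -> alpha < 1 -> noise_small_after c alpha b -> noise_small c alpha b.
Proof.
move=> c0 a1 [h [tau' [hs tauoo bh']]] e e0.
have /cvgryPge/(_ 0)[N _ /(_ N (leqnn N)) tau0] := tauoo.
set tau := tau' N in tau0; have bh := bh' N; rewrite -/tau in bh.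
have e20 : 0 < e / 2 by rewrite divr_gt0.
have [M [M0 _] hM] := near_pinfty_ex _ 0 (hs _ e20).
have /cvgryPge/(_ (`|b tau| / (e / 2))) big := profile_pinfty c alpha c0 a1.
near=> t.
have tauM : tau + M <= t by near: t; exact: nbhs_pinfty_ge (num_real _).
have Mt : M <= t - tau by rewrite lerBrDl.
have tt : tau <= t by rewrite (le_trans _ tauM)// lerDl.
have : `|b tau| / (e / 2) <= profile c alpha t by near: t.
rewrite ler_pdivrMr// => btau.
have := hM _ Mt; have := bh _ tt.
have : profile c alpha (t - tau) <= profile c alpha t.
  by apply: profile_le => //; [rewrite subr_ge0|rewrite gerBl].
move=> pp b1 b2.
have pp2 : e / 2 * profile c alpha (t - tau) <= e / 2 * profile c alpha t.
  by rewrite ler_pM2l.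
have := ler_normD (b t - b tau) (b tau); rewrite subrK.
move=> b3; lra.
Unshelve. all: by end_near. Qed.

(** * Bounds on positive paths *)

Section asymptotics.
Context {R : realType} {c alpha : R} {x b : R -> R} {T0 : R}.
Context (xeq : power_drift_from c alpha x b T0).
Context (c0 : 0 < c) (a1 : alpha < 1).
Context (x0 : forall t, T0 <= t -> 0 < x t).

Local Notation v := (profile c alpha).
Local Notation y := (fun r => x r - b r).

(** Barrier [psi r = v (m * (r + L))] with [1 < m].  While [x - b <= psi], the
    noise being at most [(m - 1) psi] gives [x <= m psi], hence
    [x^alpha <= m^alpha psi^alpha <= m psi^alpha] because [alpha < 1], and
    [m c psi^alpha] is exactly the speed of [psi].  Eventually [t + L <= m t]. *)
Lemma path_upper_pos m : 0 < alpha -> noise_small c alpha b ->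
  1 < m -> \forall t \near +oo, x t <= m * v (m * (m * t)).
Proof.
move=> a0 bs m1.
have m0 : 0 < m by rewrite (lt_trans _ m1).
have m10 : 0 < m - 1 by rewrite subr_gt0.
have [M [TM M0] bM] := near_pinfty_ex _ T0 (bs _ m10).
have /cvgryPgt/(_ (x M - b M))/(near_pinfty_ex _ 0)[L [_ L0] big] :=
  profile_pinfty c alpha c0 a1.
pose psi r := v (m * (r + L)).
have vpsi r : 0 <= r -> v r <= psi r.
  move=> r0; apply: profile_le => //.
  apply: (@le_trans _ _ (r + L)); first by rewrite lerDl ltW.
  by rewrite ler_peMl ?ltW// ltr_wpDl.
have psi0 r : 0 <= r -> 0 < psi r.
  by move=> r0; apply: profile_gt0 => //; rewrite mulr_gt0// ltr_wpDl.
near=> t.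
have Mt : M <= t by near: t; exact: nbhs_pinfty_ge (num_real _).
have xpsi r : M <= r -> 0 <= psi r - y r -> x r <= m * psi r.
  move=> Mr yr; have := bM _ Mr; have := vpsi r (ltW (lt_le_trans M0 Mr)).
  rewrite -(ler_pM2l m10) ler_norml => ? /andP[_ ?]; lra.
have : 0 < psi t - y t.
  apply: (@barrier_first R (fun r => psi r - y r) M t) => //.
  - move=> r; apply: cvgB.
      by apply: within_continuous_profile => //; rewrite addr_gt0.
    exact: (within_continuous_path xeq M t TM Mt).
  - rewrite subr_gt0 big//.
    apply: (@le_trans _ _ (M + L)); first by rewrite lerDr ltW.
    by rewrite ler_peMl ?ltW// addr_gt0.
  move=> u /andP[Mu ut] gpos.
  suff : y u - y M <= psi u - psi M by move=> ?; lra.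
  apply: (path_increment_le xeq) => //; first by rewrite addr_gt0.
  move=> r /andP[Mr ru].
  have r0 : 0 <= r by rewrite ltW// (lt_le_trans M0).
  have xr0 : 0 < x r by apply: x0; rewrite (le_trans TM).
  rewrite gtr0_norm//.
  apply: (@le_trans _ _ ((m * psi r) `^ alpha)).
    have xm : x r <= m * psi r by apply/xpsi/gpos; rewrite ?Mr.
    by apply: ge0_ler_powR;
      rewrite ?nnegrE ?(ltW a0) ?(le_trans (ltW xr0) xm) ?(ltW xr0).
  rewrite powRM ?(ltW m0) ?(ltW (psi0 _ r0))//.
  rewrite (ler_pM2r (powR_gt0 _ (psi0 _ r0))).
  by apply: ler1_powR; apply: ltW.
move=> g0; apply: (le_trans (xpsi t Mt (ltW g0))).
have t0 : 0 < t by rewrite (lt_le_trans M0).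
rewrite ler_pM2l//; apply: profile_le => //.
  by rewrite mulr_ge0 ?addr_ge0 ?ltW.
rewrite ler_pM2l//.
have : L / (m - 1) <= t by near: t; exact: nbhs_pinfty_ge (num_real _).
by rewrite ler_pdivrMr// => ?; lra.
Unshelve. all: by end_near. Qed.

(** Barrier [psi r = v (m * (r - s))] with [m < 1], issued from [0] at a
    restarting time [s = tau n].  Noise at most [(1 - m) psi] turns [psi <= x - b]
    into [m psi <= x], so [x^alpha >= m^alpha psi^alpha >= m psi^alpha].
    Since the equation [v' = c v^alpha] has [0] as another solution, the path must
    first be above [psi]: nothing is known of [h] on [[0, M]], but there the drift is
    nonnegative, so at time [s + M] it suffices that [x s] exceeds
    [psi (s + M) = v (m * M)], which holds for [n] large as [M] does not depend
    on [n]. *)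
Lemma path_lower_pos m : 0 < alpha -> noise_small_after c alpha b ->
  x t @[t --> +oo] --> +oo ->
  0 < m -> m < 1 -> \forall t \near +oo, m * v (m * (m * t)) <= x t.
Proof.
move=> a0 [h [tau [hs tauoo bh]]] xoo m0 m1.
have m10 : 0 < 1 - m by rewrite subr_gt0.
(* By homogeneity of v, psi r = k * v (r - s): the noise has to be small with
   respect to psi, hence the factor k. *)
set k := m `^ (1 - alpha)^-1.
have k0 : 0 < k by rewrite powR_gt0.
have [M [_ M0] hM] := near_pinfty_ex _ 0 (hs _ (mulr_gt0 m10 k0)).
have /cvgryPgt/(_ (v (m * M))) xbig := xoo.
have [S [TS S0] xS] := near_pinfty_ex _ T0 xbig.
have [n tauS] : exists n, S <= tau n.
  have /cvgryPge/(_ S)[N _ NS] := tauoo.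
  by exists N; exact: NS (leqnn N).
set s := tau n in tauS *.
have Ts : T0 <= s := le_trans TS tauS.
pose psi r := v (m * (r + - s)).
have psi0 r : s < r -> 0 < psi r.
  by move=> sr; apply: profile_gt0 => //; rewrite mulr_gt0// subr_gt0.
have sM r : s + M <= r -> s < r by apply: lt_le_trans; rewrite ltrDl.
have xpsi r : s + M <= r -> 0 <= y r + b s - psi r -> m * psi r <= x r.
  move=> sr yr; have := hM (r - s); rewrite lerBrDl => /(_ sr).
  have := bh n r (ltW (sM r sr)); rewrite ler_norml -/s => /andP[b1 _] h1.
  have : psi r = k * v (r - s).
    by rewrite /psi profileM ?subr_ge0 ?(ltW (sM _ _))// ltW.
  move=> E; rewrite -mulrA -E in h1; lra.
near=> t.
have Mt : s + M <= t by near: t; exact: nbhs_pinfty_ge (num_real _).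
have TsM : T0 <= s + M by rewrite (le_trans Ts)// lerDl ltW.
have : 0 < y t + b s - psi t.
  apply: (@barrier_first R (fun r => y r + b s - psi r) (s + M) t) => //.
  - move=> r; apply: cvgB; last first.
      by apply: within_continuous_profile => //; rewrite addrAC subrr add0r.
    apply: cvgD; last exact: cvg_cst.
    exact: (within_continuous_path xeq _ t TsM Mt).
  - have := path_nondecreasing xeq c0 s (s + M) Ts.
    rewrite lerDl => /(_ (ltW M0)) ymon.
    have := xS _ tauS; rewrite /psi (_ : s + M - s = M); last by ring.
    move=> ?; lra.
  move=> u /andP[Mu ut] gpos.
  suff : psi u - psi (s + M) <= y u - y (s + M) by move=> ?; lra.
  apply: (path_increment_ge xeq) => //.
    by rewrite addrAC subrr add0r.
  move=> r /andP[Mr ru].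
  have r0 : s < r := sM _ Mr.
  rewrite gtr0_norm; last by apply: x0; rewrite (le_trans Ts)// ltW.
  apply: (@le_trans _ _ ((m * psi r) `^ alpha)).
    rewrite powRM ?(ltW m0) ?(ltW (psi0 _ r0))//.
    rewrite (ler_pM2r (powR_gt0 _ (psi0 _ r0))).
    by apply: ger1_powR; rewrite ?m0 ltW.
  have mp : m * psi r <= x r by apply/xpsi/gpos; rewrite ?Mr.
  have mp0 : 0 <= m * psi r by rewrite mulr_ge0 ?ltW ?psi0.
  by apply: ge0_ler_powR; rewrite ?nnegrE ?(ltW a0)// (le_trans mp0).
move=> g0; apply: le_trans (xpsi t Mt (ltW g0)).
have t0 : 0 < t by rewrite (lt_trans S0)// (le_lt_trans tauS)// sM.
rewrite ler_pM2l//; apply: profile_le => //.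
  by rewrite !mulr_ge0 ?ltW.
rewrite ler_pM2l//.
have : s / (1 - m) <= t by near: t; exact: nbhs_pinfty_ge (num_real _).
by rewrite ler_pdivrMr// => ?; lra.
Unshelve. all: by end_near. Qed.

(** The drift is now nonincreasing.  When [x - b] is above [(1 + d) v], the path
    is above [v], its drift is at most [c v^alpha = v'], and the gap to the
    barrier [(1 + d) v + D] cannot widen; the constant [D] only takes care of the
    starting time. *)
Lemma path_upper_neg e : alpha <= 0 -> noise_small c alpha b ->
  0 < e -> \forall t \near +oo, x t <= (1 + e) * v t.
Proof.
move=> a0 bs e0.
(* Shares of the margin e * v: one for the noise, one for the barrier, one for
   the constant D. *)
have d0 : 0 < e / 4 by rewrite divr_gt0.
set d := e / 4 in d0.
have [M [TM M0] bM] := near_pinfty_ex _ T0 (bs _ d0).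
pose D := `|x M - b M|.
have v0 r : M <= r -> 0 < v r.
  by move=> Mr; apply: profile_gt0 => //; rewrite (lt_le_trans M0).
have /cvgryPge/(_ (D / d)) big := profile_pinfty c alpha c0 a1.
near=> t.
have Mt : M <= t by near: t; exact: nbhs_pinfty_ge (num_real _).
have cv : {within `[M, t], continuous v}.
  rewrite (_ : v = fun r => v (1 * (r + 0))); last first.
    by apply/funext => r; rewrite addr0 mul1r.
  by apply: within_continuous_profile; rewrite ?addr0.
have vS s r : M <= s -> s <= r -> v s <= v r.
  by move=> Ms; apply: profile_le => //; rewrite ltW// (lt_le_trans M0).
have : 0 <= (1 + d) * v t + D - y t.
  apply: (@barrier_last R (fun r => (1 + d) * v r + D - y r) M t) => //.
  - move=> r; apply: cvgB; last exact: (within_continuous_path xeq _ t TM Mt).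
    by apply: cvgD; [apply: cvgM; [exact: cvg_cst|exact: cv]|exact: cvg_cst].
  - have := v0 M (lexx _); have := ler_norm (x M - b M); rewrite -/D.
    move=> ? ?; rewrite subr_ge0 (le_trans (y := D))// lerDr.
    by rewrite mulr_ge0 ?ltW// addr_gt0.
  move=> u /andP[Mu ut] gneg.
  suff : y t - y u <= v t - v u.
    move=> ?; have := vS u t Mu ut; rewrite -(ler_pM2l d0) => ?; lra.
  have -> : v t = v (1 * (t + 0)) by rewrite addr0 mul1r.
  have -> : v u = v (1 * (u + 0)) by rewrite addr0 mul1r.
  apply: (path_increment_le xeq) => //.
  - by rewrite (le_trans TM).
  - by rewrite addr0 (lt_le_trans M0).
  move=> r /andP[ur rt]; rewrite !mul1r addr0.
  have Mr : M <= r by rewrite (le_trans Mu).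
  rewrite gtr0_norm; last by apply: x0; rewrite (le_trans TM).
  apply: ler_powR_neg; rewrite ?v0//.
  have := gneg r; rewrite ur rt => /(_ isT).
  have := bM _ Mr; rewrite ler_norml => /andP[? _].
  have : 0 <= D by exact: normr_ge0.
  move=> ? ?; lra.
have : D / d <= v t by near: t.
rewrite ler_pdivrMr//.
have := bM _ Mt; rewrite ler_norml => /andP[_].
have : v t * d = e * v t / 4 by rewrite /d; field.
rewrite mulrDl mul1r [d * _]mulrC => ->; rewrite mulrDl mul1r => ? ? ?.
have := v0 _ Mt; rewrite -(pmulr_rgt0 _ e0) => ?; lra.
Unshelve. all: by end_near. Qed.

(** Mirror image of [path_upper_neg], with the barrier [(1 - d) v - D]; as [x]
    is positive, [x <= v] gives [v^alpha <= x^alpha]. *)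
Lemma path_lower_neg e : alpha <= 0 -> noise_small c alpha b ->
  0 < e -> \forall t \near +oo, (1 - e) * v t <= x t.
Proof.
move=> a0 bs e0.
(* Shares of the margin e * v: one for the noise, one for the barrier, one for
   the constant D. *)
have d0 : 0 < e / 4 by rewrite divr_gt0.
set d := e / 4 in d0.
have [M [TM M0] bM] := near_pinfty_ex _ T0 (bs _ d0).
pose D := v M + `|x M - b M|.
have v0 r : M <= r -> 0 < v r.
  by move=> Mr; apply: profile_gt0 => //; rewrite (lt_le_trans M0).
have D0 : 0 <= D by rewrite addr_ge0 ?normr_ge0 ?ltW ?v0.
have /cvgryPge/(_ (D / d)) big := profile_pinfty c alpha c0 a1.
near=> t.
have Mt : M <= t by near: t; exact: nbhs_pinfty_ge (num_real _).
have cv : {within `[M, t], continuous v}.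
  rewrite (_ : v = fun r => v (1 * (r + 0))); last first.
    by apply/funext => r; rewrite addr0 mul1r.
  by apply: within_continuous_profile; rewrite ?addr0.
have vS s r : M <= s -> s <= r -> v s <= v r.
  by move=> Ms; apply: profile_le => //; rewrite ltW// (lt_le_trans M0).
have : 0 <= y t - (1 - d) * v t + D.
  apply: (@barrier_last R (fun r => y r - (1 - d) * v r + D) M t) => //.
  - move=> r; apply: cvgD; last exact: cvg_cst.
    apply: cvgB; first exact: (within_continuous_path xeq _ t TM Mt).
    by apply: cvgM; [exact: cvg_cst|exact: cv].
  - have := v0 M (lexx _); have := ler_norm (- (x M - b M)).
    rewrite normrN /D -(pmulr_rgt0 _ d0) => ? ?; lra.
  move=> u /andP[Mu ut] gneg.
  suff : v t - v u <= y t - y u.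
    move=> ?; have := vS u t Mu ut; rewrite -(ler_pM2l d0) => ?; lra.
  have -> : v t = v (1 * (t + 0)) by rewrite addr0 mul1r.
  have -> : v u = v (1 * (u + 0)) by rewrite addr0 mul1r.
  apply: (path_increment_ge xeq) => //.
  - by rewrite (le_trans TM).
  - by rewrite addr0 (lt_le_trans M0).
  move=> r /andP[ur rt]; rewrite !mul1r addr0.
  have Mr : M <= r by rewrite (le_trans Mu).
  have xr0 : 0 < x r by apply: x0; rewrite (le_trans TM).
  rewrite gtr0_norm//; apply: ler_powR_neg; rewrite ?v0//.
  have := gneg r; rewrite ur rt => /(_ isT).
  have := bM _ Mr; rewrite ler_norml => /andP[_ ?] ?; lra.
have : D / d <= v t by near: t.
rewrite ler_pdivrMr//.
have := bM _ Mt; rewrite ler_norml => /andP[+ _].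
have : v t * d = e * v t / 4 by rewrite /d; field.
rewrite mulrBl mul1r [d * _]mulrC => ->; rewrite mulrBl mul1r => ? ? ?.
have := v0 _ Mt; rewrite -(pmulr_rgt0 _ e0) => ?; lra.
Unshelve. all: by end_near. Qed.

End asymptotics.

(** * Equivalence along a single trajectory *)

Lemma equiv_pinfty_bounds {R : realType} (u v : R -> R) :
  (\forall t \near +oo, 0 < v t) ->
  (forall k, 1 < k -> \forall t \near +oo, u t <= k * v t) ->
  (forall k, 0 < k -> k < 1 -> \forall t \near +oo, k * v t <= u t) ->
  equiv_pinfty u v.
Proof.
move=> v0 up lo; apply/cvgrPdist_le => e e0.
pose k := 1 - Num.min e 2^-1.
have m0 : 0 < Num.min e 2^-1 by rewrite lt_min e0 invr_gt0/=.
have k0 : 0 < k.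
  by rewrite subr_gt0 gt_min invf_lt1// ltr1n orbT.
have k1 : k < 1 by rewrite ltrBlDr ltrDl.
have ke : 1 - e <= k by rewrite lerD2l lerN2 ge_min lexx.
have e1 : 1 < 1 + e by rewrite ltrDl.
near=> t.
have vt : 0 < v t by near: t.
rewrite distrC ler_distl; apply/andP; split.
  by rewrite (le_trans ke)// ler_pdivlMr//; near: t; exact: lo.
by rewrite ler_pdivrMr//; near: t; exact: up.
Unshelve. all: by end_near. Qed.

Definition admissible_noise {R : realType} (c alpha : R) (b : R -> R) :=
  (0 < alpha < 1 /\ noise_small_after c alpha b) \/
  (alpha <= 0 /\ noise_small c alpha b).

(** For [0 < alpha] the barriers bound the path by [m * v (m^2 t)], that is by
    [m^(1 + 2 b') * v t] with [b' = 1 / (1 - alpha)]: a bound [k * v t] is reached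
    with [m = k^(1 / (1 + 2 b'))]. *)
Lemma path_equiv_profile {R : realType} (c alpha : R) (x b : R -> R) (T0 : R) :
  power_drift_from c alpha x b T0 -> 0 < c ->
  (forall t, T0 <= t -> 0 < x t) -> x t @[t --> +oo] --> +oo ->
  admissible_noise c alpha b ->
  equiv_pinfty x (profile c alpha).
Proof.
move=> xeq c0 x0 xoo noise.
have a1 : alpha < 1.
  by case: noise => [[/andP[]//]|[/le_lt_trans]] + _; apply.
have vpos : \forall t \near +oo, 0 < profile c alpha t.
  near=> t; apply: profile_gt0 => //; near: t; exact: nbhs_pinfty_gt (num_real _).
case: noise => [[/andP[a0 _] na]|[a0 nb]].
  pose b' := (1 - alpha)^-1; have b'0 : 0 < b' by rewrite invr_gt0 subr_gt0.
  have q0 : 0 < 1 + 2 * b' by rewrite addr_gt0// mulr_gt0.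
  have mE (k t : R) : 0 < k -> 0 <= t -> let m := k `^ (1 + 2 * b')^-1 in
      m * profile c alpha (m * (m * t)) = k * profile c alpha t.
    move=> k0 t0 m; have m0 : 0 <= m by exact: powR_ge0.
    rewrite !profileM ?mulr_ge0// -/b'.
    rewrite (_ : k = m * (m `^ b' * m `^ b')); first by rewrite -!mulrA.
    rewrite -powRD; last by rewrite gt_eqF ?addr_gt0.
    rewrite -{1}(powRr1 m0) -powRD; last first.
      by rewrite gt_eqF// addr_gt0// addr_gt0.
    rewrite -powRrM (_ : 1 + (b' + b') = 1 + 2 * b'); last by ring.
    by rewrite mulVf ?gt_eqF// powRr1// ltW.
  have nb : noise_small c alpha b by exact: noise_small_after_small.
  apply: equiv_pinfty_bounds => // k.
    move=> k1; have k0 : 0 < k by rewrite (lt_trans _ k1).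
    have m1 : 1 < k `^ (1 + 2 * b')^-1.
      have : 1 `^ (1 + 2 * b')^-1 < k `^ (1 + 2 * b')^-1.
        by apply: gt0_ltr_powR; rewrite ?invr_gt0 ?nnegrE ?(ltW k0).
      by rewrite powR1.
    near=> t; have t0 : 0 <= t by near: t; exact: nbhs_pinfty_ge (num_real _).
    by rewrite -mE//; near: t; exact: (path_upper_pos xeq).
  move=> k0 k1.
  have m0 : 0 < k `^ (1 + 2 * b')^-1 by exact: powR_gt0.
  have m1 : k `^ (1 + 2 * b')^-1 < 1.
    have : k `^ (1 + 2 * b')^-1 < 1 `^ (1 + 2 * b')^-1.
      by apply: gt0_ltr_powR; rewrite ?invr_gt0 ?nnegrE ?(ltW k0).
    by rewrite powR1.
  near=> t; have t0 : 0 <= t by near: t; exact: nbhs_pinfty_ge (num_real _).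
  by rewrite -mE//; near: t; exact: (path_lower_pos xeq).
apply: equiv_pinfty_bounds => // k.
  move=> k1; have := path_upper_neg xeq c0 a1 x0 (k - 1) a0 nb.
  by rewrite subr_gt0 => /(_ k1); rewrite addrC subrK.
move=> k0 k1; have := path_lower_neg xeq c0 a1 x0 (1 - k) a0 nb.
by rewrite subr_gt0 => /(_ k1); rewrite opprB addrC subrK.
Unshelve. all: by end_near. Qed.

(** [F] is real-valued only from [T0] on, so the splitting of the integral is
    done in the extended reals before passing to [f]. *)
Lemma integral_increment {R : realType} (F : R -> \bar R) (f x b : R -> R)
    (T0 : R) :
  (forall t, 0 <= t ->
    (@lebesgue_measure R).-integrable `[0, t] F /\
    (x t)%:E =
      (\int[@lebesgue_measure R]_(r in `[0%R, t]) F r + (b t)%:E)%E) ->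
  0 <= T0 -> (forall r, T0 <= r -> F r = (f r)%:E) ->
  forall s t, T0 <= s -> s <= t ->
    (@lebesgue_measure R).-integrable `[s, t] (EFin \o f) /\
    (x t - b t) - (x s - b s) = \int[@lebesgue_measure R]_(r in `[s, t]) f r.
Proof.
move=> H T00 Ff s t Ts st.
have s0 : 0 <= s := le_trans T00 Ts.
have [is_ xs] := H s s0.
have [it xt] := H t (le_trans s0 st).
have iF : (@lebesgue_measure R).-integrable `[s, t] F.
  apply: integrableS it => // r /=; rewrite !in_itv/= => /andP[sr ->].
  by rewrite (le_trans s0).
have ist : (@lebesgue_measure R).-integrable `[s, t] (EFin \o f).
  apply: eq_integrable iF => // r; rewrite inE/= in_itv/= => /andP[sr _].
  by rewrite Ff// (le_trans Ts).
split => //.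
have E : (\int[@lebesgue_measure R]_(r in `[0%R, t]) F r =
    \int[@lebesgue_measure R]_(r in `[0%R, s]) F r +
    \int[@lebesgue_measure R]_(r in `[s, t]) (f r)%:E)%E.
  rewrite (@itv_bndbnd_setU _ _ (BLeft 0) (BRight s) (BRight t)) ?bnd_simp//.
  rewrite integral_setU//=.
  - congr (_ + _)%E; rewrite integral_itv_obnd_cbnd.
      apply: eq_integral => r; rewrite inE/= in_itv/= => /andP[sr _].
      by rewrite Ff// (le_trans Ts).
    apply: measurable_funS (measurable_int _ iF) => //.
    by apply: subset_itvr; rewrite bnd_simp.
  - rewrite -itv_bndbnd_setU ?bnd_simp//.
    exact: measurable_int it.
  - apply/disj_setPS => r /=; rewrite !in_itv/= => -[/andP[_ rs] /andP[]].
    by rewrite ltNge rs.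
have I1 : (\int[@lebesgue_measure R]_(r in `[0%R, s]) F r)%E \is a fin_num.
  exact: integrable_fin_num is_.
have I2 : (\int[@lebesgue_measure R]_(r in `[s, t]) (f r)%:E)%E \is a fin_num.
  exact: integrable_fin_num ist.
move: xt xs; rewrite E /Rintegral -(fineK I1) -[X in (_ + X + _)%E](fineK I2) -!EFinD.
by move=> [->] [->]; ring.
Qed.

Lemma drift_pos {R : realType} (cp cm alpha x : R) : 0 < x ->
  drift cp cm alpha x = (cp * `|x| `^ alpha)%:E.
Proof.
move=> x0; rewrite /drift /abs_pow gt_eqF//= !indicE mem_set/=; last exact: ltW.
rewrite memNset/=; last by rewrite ltNge ltW.
by rewrite mulr1 mulr0 subr0.
Qed.

Lemma drift_neg {R : realType} (cp cm alpha x : R) : x < 0 ->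
  drift cp cm alpha x = (- (cm * `|x| `^ alpha))%:E.
Proof.
move=> x0; rewrite /drift /abs_pow lt_eqF//= !indicE.
rewrite [in X in (X * _)%E]memNset/=; last first.
  by rewrite leNgt x0.
by rewrite mem_set//= mulr0 mulr1 sub0r -EFinM mulNr.
Qed.

Lemma littleo_profile {R : realType} (c alpha : R) (f : R -> R) :
  0 < c -> alpha < 1 -> f =o_+oo (fun t => t `^ (1 - alpha)^-1) ->
  noise_small c alpha f.
Proof.
move=> c0 a1 /eqoP fo e e0.
have ca : 0 < c * (1 - alpha) by rewrite mulr_gt0 ?subr_gt0.
have k0 : 0 < (c * (1 - alpha)) `^ (1 - alpha)^-1 by rewrite powR_gt0.
near=> t.
have t0 : 0 <= t by near: t; exact: nbhs_pinfty_ge (num_real _).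
rewrite /profile powRM ?(ltW ca)// mulrA -[X in _ * X]ger0_norm ?powR_ge0//.
by near: t; apply: fo; rewrite mulr_gt0.
Unshelve. all: by end_near. Qed.

Lemma admissible_noise_opp {R : realType} (c alpha : R) (b : R -> R) :
  admissible_noise c alpha b -> admissible_noise c alpha (fun t => - b t).
Proof.
move=> [[a01 [h [tau [hs tauoo bh]]]]|[a0 bs]]; [left|right]; split => //.
  exists h, tau; split => // n t tt.
  by rewrite -opprD normrN; exact: bh.
by move=> e e0; under eq_near do rewrite normrN; exact: bs.
Qed.

Definition solution_path {R : realType} (cp cm alpha : R) (x b : R -> R) :=
  forall t, 0 <= t ->
    (@lebesgue_measure R).-integrable `[0, t]
      (fun s => drift cp cm alpha (x s)) /\
    (x t)%:E = (\int[@lebesgue_measure R]_(s in `[0%R, t])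
                  drift cp cm alpha (x s) + (b t)%:E)%E.

Lemma solution_equiv_pinfty {R : realType} (cp cm alpha : R) (x b : R -> R) :
  solution_path cp cm alpha x b ->
  0 < cp ->
  admissible_noise cp alpha b ->
  x t @[t --> +oo] --> +oo -> equiv_pinfty x (profile cp alpha).
Proof.
move=> xeq c0 noise xoo.
have /cvgryPgt/(_ 0)/(near_pinfty_ex _ 0)[T0 [T00 _] x0] := xoo.
apply: (@path_equiv_profile R cp alpha x b T0) => //.
by apply: integral_increment xeq T00 _ => r Tr; rewrite drift_pos// x0.
Qed.

(** The pair [(- x, - b)] solves the equation with [cm] in place of [cp] as soon
    as [x] stays negative. *)
Lemma solution_equiv_ninfty {R : realType} (cp cm alpha : R) (x b : R -> R) :
  solution_path cp cm alpha x b ->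
  0 < cm ->
  admissible_noise cm alpha b ->
  x t @[t --> +oo] --> -oo -> equiv_pinfty x (fun t => - profile cm alpha t).
Proof.
move=> xeq c0 noise xoo.
have xoo' : - x t @[t --> +oo] --> +oo by exact/cvgNry.
have /cvgryPgt/(_ 0)/(near_pinfty_ex _ 0)[T0 [T00 _] x0] := xoo'.
have : equiv_pinfty (fun t => - x t) (profile cm alpha).
  apply: (@path_equiv_profile R cm alpha _ (fun t => - b t) T0) => //;
    last exact: admissible_noise_opp.
  have Ff r : T0 <= r ->
      drift cp cm alpha (x r) = (- (cm * `|x r| `^ alpha))%:E.
    by move=> /x0; rewrite oppr_gt0 => /drift_neg ->.
  move=> s t Ts st.
  have [intf E] := @integral_increment R _ _ x b T0 xeq T00 Ff s t Ts st.
  have intN : (@lebesgue_measure R).-integrable `[s, t]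
      (EFin \o (fun r => cm * `|- x r| `^ alpha)).
    have -> : EFin \o (fun r => cm * `|- x r| `^ alpha) =
        (\- (EFin \o (fun r : R => (- (cm * `|x r| `^ alpha))%R)))%E.
      by apply/funext => r /=; rewrite normrN opprK.
    exact: integrableN.
  split => //.
  rewrite (_ : _ - _ - _ = - (x t - b t - (x s - b s))); last by ring.
  rewrite E -[LHS]mulN1r -RintegralZl//.
  by apply: eq_Rintegral => r _; rewrite normrN mulN1r opprK.
rewrite /equiv_pinfty; apply: cvg_trans; apply: near_eq_cvg.
by near=> t; rewrite invrN mulrN mulNr.
Unshelve. all: by end_near. Qed.

Theorem theorem4p1 (d : measure_display) (T : measurableType d)
    (R : realType) (P : probability T R) (cp cm alpha : R)
    (B X : R -> {RV P >-> R})
    (cp_gt0 : 0 < cp) (cm_gt0 : 0 < cm)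
    (B_cadlag : forall w, cadlag (fun t => B t w))
    (X_cadlag : forall w, cadlag (fun t => X t w))
    (X_sol : solves_SDE cp cm alpha B X)
    (hyp :
      ((0 < alpha < 1) /\
       exists (h : R -> R) (tau : nat -> {RV P >-> R}),
         h =o_+oo (fun t => t `^ (1 - alpha)^-1) /\
         {ae P, forall w,
           [/\ forall n, 0 <= tau n w,
               tau n w @[n --> \oo] --> +oo &
               forall n t, tau n w <= t ->
                 `|B t w - B (tau n w) w| <= h (t - tau n w)]})
      \/
      ((-1 < alpha <= 0) /\
       {ae P, forall w,
         (fun t => B t w) =o_+oo (fun t => t `^ (1 - alpha)^-1)})) :
  {ae P, forall w, X t w @[t --> +oo] --> +oo ->
    equiv_pinfty (fun t => X t w)
      (fun t => (cp * (1 - alpha) * t) `^ (1 - alpha)^-1)} /\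
  {ae P, forall w, X t w @[t --> +oo] --> -oo ->
    equiv_pinfty (fun t => X t w)
      (fun t => - (cm * (1 - alpha) * t) `^ (1 - alpha)^-1)}.
Proof.
have noise c : 0 < c ->
    {ae P, forall w, admissible_noise c alpha (fun t => B t w)}.
  move=> c0; case: hyp => [[a01 [h [tau [ho Bh]]]]|[/andP[_ a0] Bo]].
    have a1 : alpha < 1 by case/andP: a01.
    apply: filterS Bh => w [_ tauoo Bh]; left; split => //.
    exists h, (fun n => tau n w); split => // e e0.
    have := littleo_profile c alpha h c0 a1 ho e e0.
    by apply: filterS => u; apply: le_trans; exact: ler_norm.
  have a1 : alpha < 1 := le_lt_trans a0 ltr01.
  by apply: filterS Bo => w Bo; right; split => //; exact: littleo_profile.
split.
  apply: filterS2 X_sol (noise cp cp_gt0) => w xeq nw.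
  exact: (solution_equiv_pinfty _ _ _ _ _ xeq).
apply: filterS2 X_sol (noise cm cm_gt0) => w xeq nw.
exact: (solution_equiv_ninfty _ _ _ _ _ xeq).
Qed.
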